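(* Let $\mathcal A$ be a $d$-dimensional point configuration with $n$ points. Then there exist $m\le n$ and a $(d+m)$-dimensional polytope $P$ with $n+m$ vertices such that $\mathcal A$ and the vertex set of $P$ have isomorphic secondary polytopes.
   Context: A point configuration is a finite multiset of points (repetitions allowed); its dimension is that of its affine hull. The secondary polytope $\Sigma\text{-poly}(\mathcal A)$ of a point configuration $\mathcal A$ (Gel'fand–Kapranov–Zelevinsky) is a polytope whose face poset is isomorphic to the poset of all regular subdivisions of $\mathcal A$ ordered by refinement; ''isomorphic secondary polytopes'' means combinatorially isomorphic, i.e. the posets of regular subdivisions are isomorphic. Regular subdivisions of $\mathcal A$ are those induced by lifting each $a\in\mathcal A$ to height $w(a)$ for some $w:\mathcal A\to\mathbb R$ and projecting the lower faces of the lifted convex hull. *)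

(* Defs.v *)
From HB Require Import structures.
From mathcomp Require Import all_boot all_order all_algebra.
From mathcomp Require Import all_classical all_reals.

Set Implicit Arguments.
Unset Strict Implicit.
Unset Printing Implicit Defensive.

Import Order.TTheory GRing.Theory Num.Theory.

Local Open Scope classical_set_scope.
Local Open Scope ring_scope.

Section Polytopes.
Context {R : realType} {k : nat}.
Implicit Types (X P F : set 'rV[R]_k) (c : 'cV[R]_k).

Definition affine_hull X : set 'rV[R]_k :=
  [set y | exists (q : nat) (x : 'I_q -> 'rV[R]_k) (l : 'I_q -> R),
     [/\ forall i, X (x i), \sum_i l i = 1 & y = \sum_i l i *: x i]].

Definition convex_hull X : set 'rV[R]_k :=
  [set y | exists (q : nat) (x : 'I_q -> 'rV[R]_k) (l : 'I_q -> R),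
     [/\ forall i, X (x i), forall i, 0 <= l i, \sum_i l i = 1
       & y = \sum_i l i *: x i]].

(* The affine hull is a translate of a d-dimensional linear subspace; this is
   false for every d when X is empty. *)
Definition has_dimension X (d : nat) : Prop :=
  exists (x0 : 'rV[R]_k) (V : {vspace 'rV[R]_k}),
    \dim V = d /\ affine_hull X = [set x0 + v | v in [set v | v \in V]].

Definition is_polytope P : Prop :=
  exists X, finite_set X /\ P = convex_hull X.

(* The face of P in direction c, where the linear functional x |-> x *m c
   attains its minimum over P. *)
Definition face P c : set 'rV[R]_k :=
  [set x | P x /\ forall y, P y -> (x *m c) 0 0 <= (y *m c) 0 0].

Definition vertices P : set 'rV[R]_k :=
  [set v | exists c, face P c = [set v]].

End Polytopes.

(* A point configuration with n points is a family a : 'I_n -> 'rV[R]_k, so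
   that points may be repeated; its subsets are sets of labels. *)
Section RegularSubdivisions.
Context {R : realType} {k n : nat}.
Implicit Types (a : 'I_n -> 'rV[R]_k) (w : 'I_n -> R) (C : {set 'I_n}).

Definition lift_config a w : 'I_n -> 'rV[R]_(k + 1) :=
  fun i => row_mx (a i) (w i)%:M.

Definition lower_face (P F : set 'rV[R]_(k + 1)) : Prop :=
  exists c : 'cV[R]_(k + 1), 0 < c (rshift k 0) 0 /\ F = face P c.

(* Cells are recorded by the labels of the lifted points lying on a lower face,
   and not only by the projection of that face: this marking is part of the
   data of a subdivision of a configuration. *)
Definition is_cell a w C : Prop :=
  exists F, lower_face (convex_hull (range (lift_config a w))) F /\
    forall i, i \in C <-> F (lift_config a w i).

Definition induced_subdivision a w : {set {set 'I_n}} :=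
  [set C | `[< is_cell a w C >]]%SET.

Definition regular_subdivisions a : set {set {set 'I_n}} :=
  range (induced_subdivision a).

Definition refines (S T : {set {set 'I_n}}) : Prop :=
  forall C, C \in S -> exists2 D, D \in T & C \subset D.

End RegularSubdivisions.

(* The face poset of the secondary polytope of a is the poset of regular
   subdivisions of a ordered by refinement. *)
Definition isomorphic_secondary_polytopes {R : realType} {k n k' n' : nat}
    (a : 'I_n -> 'rV[R]_k) (b : 'I_n' -> 'rV[R]_k') : Prop :=
  exists f : {set {set 'I_n}} -> {set {set 'I_n'}},
    set_bij (regular_subdivisions a) (regular_subdivisions b) f /\
    forall S T, regular_subdivisions a S -> regular_subdivisions a T ->
      (refines S T <-> refines (f S) (f T)).

(* Main.v *)
Require Import Defs.
From HB Require Import structures.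
From mathcomp Require Import all_boot all_order all_algebra.
From mathcomp Require Import all_classical all_reals.
From mathcomp Require Import lra.

Set Implicit Arguments.
Unset Strict Implicit.
Unset Printing Implicit Defensive.

Import Order.TTheory GRing.Theory Num.Theory.

Local Open Scope classical_set_scope.
Local Open Scope ring_scope.

(** Take [m = n] and let [P] be the convex hull of the points [(a_i, e_i)] and
    [(a_i, - e_i)].  Dually, every vector of the Gale diagram is doubled, which
    does not change its chamber fan.  Up to adding a linear function, a height
    function on these [2n] points gives both copies of [a_i] the same height
    [w_i]; the cells it induces are then exactly the nonempty sets of labels
    for which the set of doubly occurring [i] is empty or a cell of the
    subdivision of [a] induced by [w].  This correspondence is injective and
    respects refinement in both directions. *)

(** * Faces, vertices and affine hulls of finitely generated hulls *)

Section Hulls.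
Context {R : realType} {k : nat}.

Lemma convex_hull_sub (X : set 'rV[R]_k) : X `<=` convex_hull X.
Proof.
move=> x Xx; exists 1%N, (fun=> x), (fun=> 1); split => //.
  by rewrite big_ord1.
by rewrite big_ord1 scale1r.
Qed.

Lemma convex_hull_functional_ge (X : set 'rV[R]_k) (c : 'cV[R]_k) (mu : R) :
  (forall x, X x -> mu <= (x *m c) 0 0) ->
  forall y, convex_hull X y -> mu <= (y *m c) 0 0.
Proof.
move=> muX y [q [x [l [Xx l0 l1 ->]]]].
rewrite mulmx_suml summxE -[mu]mul1r -l1 mulr_suml.
by apply: ler_sum => i _; rewrite -scalemxAl mxE ler_wpM2l// muX.
Qed.

Lemma face_convex_hull_gen (X : set 'rV[R]_k) (c : 'cV[R]_k) (x : 'rV[R]_k) :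
  X x ->
  face (convex_hull X) c x <-> (forall y, X y -> (x *m c) 0 0 <= (y *m c) 0 0).
Proof.
move=> Xx; split => [[_ xmin] y Xy|xmin].
  exact/xmin/convex_hull_sub.
by split; [exact: convex_hull_sub|exact: convex_hull_functional_ge].
Qed.

(** At a minimizer written as a convex combination, the weighted excesses over the value at [v] are
    nonnegative and sum to zero. Each therefore vanishes, so all the weight sits on [v]. *)
Lemma vertices_unique_min (X : set 'rV[R]_k) (c : 'cV[R]_k) (v : 'rV[R]_k) :
  X v -> (forall x, X x -> x <> v -> (v *m c) 0 0 < (x *m c) 0 0) ->
  vertices (convex_hull X) v.
Proof.
move=> Xv vmin; exists c.
have vle x : X x -> (v *m c) 0 0 <= (x *m c) 0 0.
  by move=> Xx; have [->//|/eqP xv] := eqVneq x v; exact/ltW/vmin.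
apply/seteqP; split => [y [[q [x [l [Xx l0 l1 ->]]]] ymin]|_ ->]; last first.
  exact/face_convex_hull_gen.
have gap_ge0 i : 0 <= l i * ((x i *m c) 0 0 - (v *m c) 0 0).
  by rewrite mulr_ge0// subr_ge0 vle.
have gap0 : \sum_i l i * ((x i *m c) 0 0 - (v *m c) 0 0) = 0.
  apply/eqP; rewrite eq_le sumr_ge0// andbT.
  under eq_bigr do rewrite mulrBr.
  rewrite sumrB -mulr_suml l1 mul1r subr_le0.
  have := ymin v (convex_hull_sub Xv); rewrite mulmx_suml summxE.
  by under eq_bigr do rewrite -scalemxAl mxE.
have {}gap0 i : l i * ((x i *m c) 0 0 - (v *m c) 0 0) = 0.
  by have /psumr_eq0P := gap0; apply.
rewrite /= -[RHS]scale1r -l1 scaler_suml; apply: eq_bigr => i _.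
have [->//|/eqP xv] := eqVneq (x i) v.
have /eqP := gap0 i; rewrite mulf_eq0 => /orP[/eqP->|]; first by rewrite !scale0r.
by rewrite subr_eq0 => /eqP E; have := vmin _ (Xx i) xv; rewrite E ltxx.
Qed.

(** Choosing a label for each point of the combination and adding up the weights with the same label
    makes the labels themselves the index set. *)
Lemma affine_hull_range n (a : 'I_n -> 'rV[R]_k) (y : 'rV[R]_k) :
  affine_hull (range a) y ->
  exists l : 'I_n -> R, \sum_i l i = 1 /\ y = \sum_i l i *: a i.
Proof.
move=> [q [x [l [ax l1 ->]]]].
have /choice[g gE] : forall j, exists i, a i = x j.
  by move=> j; have [i _ <-] := ax j; exists i.
exists (fun i => \sum_(j | g j == i) l j); split.
  by rewrite -l1 (partition_big g xpredT).
rewrite (partition_big g xpredT)//=; apply: eq_bigr => i _.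
by rewrite scaler_suml; apply: eq_bigr => j /eqP <-; rewrite gE.
Qed.

End Hulls.

(** * Cells as sets of minimizing labels *)

Section Argmin.
Context {R : realType}.

Definition argmin n (h : 'I_n -> R) : {set 'I_n} :=
  [set i | [forall j, h i <= h j]]%SET.

Lemma argminP n (h : 'I_n -> R) i :
  reflect (forall j, h i <= h j) (i \in argmin h).
Proof. by rewrite inE; exact: forallP. Qed.

Lemma argmin_neq0 n (h : 'I_n -> R) : (0 < n)%N -> argmin h != finset.set0.
Proof.
case: n h => // n h _; apply/set0Pn.
case: (arg_minP h (isT : xpredT (ord0 : 'I_n.+1))) => i _ imin.
by exists i; apply/argminP => j; exact: imin.
Qed.

Lemma argmin_level n (h : 'I_n -> R) (mu : R) (C : {set 'I_n}) :
  C != finset.set0 -> (forall i, mu <= h i) ->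
  (forall i, (i \in C) = (h i == mu)) -> argmin h = C.
Proof.
move=> /set0Pn[i0 i0C] muh CE; apply/setP => i; rewrite CE.
have /eqP h0 : h i0 == mu by rewrite -CE.
apply/argminP/eqP => [imin|-> //].
by apply/eqP; rewrite eq_le muh -h0 imin.
Qed.

Lemma is_cellP k n (a : 'I_n -> 'rV[R]_k) (w : 'I_n -> R) (C : {set 'I_n}) :
  is_cell a w C <->
  exists c : 'cV[R]_k, C = argmin (fun i => (a i *m c) 0 0 + w i).
Proof.
have liftE (c : 'cV[R]_(k + 1)) i :
    (lift_config a w i *m c) 0 0
    = (a i *m usubmx c) 0 0 + c (rshift k 0) 0 * w i.
  rewrite /lift_config -{1}[c]vsubmxK mul_row_col mxE.
  by rewrite mul_scalar_mx !mxE mulrC.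
split=> [[F [[c [c0 ->]]] CF]|[c ->]].
  exists ((c (rshift k 0) 0)^-1 *: usubmx c); apply/setP => i.
  have hE j : (a j *m ((c (rshift k 0) 0)^-1 *: usubmx c)) 0 0 + w j
      = (c (rshift k 0) 0)^-1 * (lift_config a w j *m c) 0 0.
    by rewrite liftE mulrDr mulKf ?gt_eqF// -scalemxAr mxE.
  apply/idP/argminP => [iC j|imin].
    move/CF: iC; rewrite face_convex_hull_gen; last by exists i.
    by rewrite !hE ler_pM2l ?invr_gt0//; apply; exists j.
  apply/CF/face_convex_hull_gen; first by exists i.
  by move=> _ [j _ <-]; move: (imin j); rewrite !hE ler_pM2l ?invr_gt0.
pose c' : 'cV[R]_(k + 1) := col_mx c 1%:M.
have c'1 : c' (rshift k 0) 0 = 1 by rewrite col_mxEd mxE eqxx.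
exists (face (convex_hull (range (lift_config a w))) c'); split.
  by exists c'; rewrite c'1.
move=> i; rewrite face_convex_hull_gen; last by exists i.
split=> [/argminP imin _ [j _ <-]|imin].
  by rewrite !liftE c'1 !mul1r col_mxKu; exact: imin.
apply/argminP => j; have := imin _ (ex_intro2 _ _ j I erefl).
by rewrite !liftE c'1 !mul1r col_mxKu.
Qed.

Lemma in_induced_subdivision k n (a : 'I_n -> 'rV[R]_k) w C :
  C \in induced_subdivision a w <->
  exists c : 'cV[R]_k, C = argmin (fun i => (a i *m c) 0 0 + w i).
Proof. by rewrite -is_cellP inE; split=> /asboolP. Qed.

End Argmin.

(** * Combinatorics of doubling a subdivision *)

Section DoubledCells.
Context {n : nat}.
Implicit Types (S T : {set {set 'I_n}}) (C : {set 'I_(n + n)}).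

Definition doubled C : {set 'I_n} :=
  [set i | (lshift n i \in C) && (rshift n i \in C)]%SET.

Definition both (D : {set 'I_n}) : {set 'I_(n + n)} :=
  [set j | match fintype.split j with inl i => i \in D | inr i => i \in D end]%SET.

(** Nonempty sets containing no complete pair are cells whatever [S] is; all information about [S]
    lies in the complete pairs. *)
Definition double_subdivision S : {set {set 'I_(n + n)}} :=
  [set C | (C != finset.set0)
           && ((doubled C == finset.set0) || (doubled C \in S))]%SET.

Lemma in_both_l D i : (lshift n i \in both D) = (i \in D).
Proof. by rewrite inE (unsplitK (inl i)). Qed.

Lemma in_both_r D i : (rshift n i \in both D) = (i \in D).
Proof. by rewrite inE (unsplitK (inr i)). Qed.

Lemma doubled_setU_both C D : doubled (C :|: both D) = doubled C :|: D.
Proof.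
apply/setP => i; rewrite inE !finset.in_setU in_both_l in_both_r inE.
by rewrite -orb_andl.
Qed.

Lemma doubled_both D : doubled (both D) = D.
Proof. by apply/setP => i; rewrite inE in_both_l in_both_r andbb. Qed.

Lemma doubledS C C' : C \subset C' -> doubled C \subset doubled C'.
Proof.
move=> /fintype.subsetP CC'; apply/fintype.subsetP => i; rewrite !inE.
by move=> /andP[/CC' -> /CC' ->].
Qed.

Lemma both_neq0 D : (both D != finset.set0) = (D != finset.set0).
Proof.
apply/set0Pn/set0Pn => [[j]|[i iD]].
  by rewrite inE; case: fintype.split => i iD; exists i.
by exists (lshift n i); rewrite in_both_l.
Qed.

Lemma both_double_subdivision S D :
  D != finset.set0 -> (both D \in double_subdivision S) = (D \in S).
Proof. by move=> D0; rewrite inE both_neq0 doubled_both (negPf D0). Qed.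

Lemma refines_double_subdivision S T : (forall D, D \in S -> D != finset.set0) ->
  refines S T <-> refines (double_subdivision S) (double_subdivision T).
Proof.
move=> S0; split=> ST.
  move=> C; rewrite inE => /andP[C0 /orP[D0|/ST[E ET DE]]].
    by exists C => //; rewrite inE C0 D0.
  (* Since [doubled C] lies in [E], adding both copies of [E] completes no pair outside [E]. *)
  exists (C :|: both E); last exact: finset.subsetUl.
  rewrite inE doubled_setU_both (finset.setUidPr DE) ET orbT andbT.
  by apply: contra C0 => /eqP; rewrite -!finset.subset0 => <-; exact: finset.subsetUl.
(* Conversely, it suffices to test refinement on the cells [both D]; nonemptiness of [D] rules out a
   larger cell without complete pairs. *)
move=> D DS; have D0 := S0 _ DS.
have /ST[C] : both D \in double_subdivision S by rewrite both_double_subdivision.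
rewrite inE => /andP[_ CT] /doubledS; rewrite doubled_both => DC.
exists (doubled C) => //; move: CT => /orP[/eqP C0|//].
by move: DC; rewrite C0 finset.subset0 (negPf D0).
Qed.

Lemma double_subdivision_inj S T :
  (forall D, D \in S -> D != finset.set0) ->
  (forall D, D \in T -> D != finset.set0) ->
  double_subdivision S = double_subdivision T -> S = T.
Proof.
move=> S0 T0 ST; apply/setP => D; have [->|D0] := eqVneq D finset.set0.
  by apply/idP/idP => [/S0|/T0]; rewrite eqxx.
by rewrite -(both_double_subdivision S) // ST both_double_subdivision.
Qed.

End DoubledCells.

(** * Minimum sets of heights on pairs *)

Section DoubledHeights.
Context {R : realType} {n : nat}.
Implicit Types (h r : 'I_n -> R) (C : {set 'I_(n + n)}).

(** Every height function on the pairs has this form, with [h] the mean and [r] half the difference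
    of the two values. *)
Definition split_height h r (j : 'I_(n + n)) : R :=
  match fintype.split j with inl i => h i + r i | inr i => h i - r i end.

Lemma split_height_l h r i : split_height h r (lshift n i) = h i + r i.
Proof. by rewrite /split_height (unsplitK (inl i)). Qed.

Lemma split_height_r h r i : split_height h r (rshift n i) = h i - r i.
Proof. by rewrite /split_height (unsplitK (inr i)). Qed.

(** The lower value on the pair [j] is [h j - |r j|]. If both copies of [i] are minimal, then
    [r i = 0] and [h i] is the minimum, so the complete pairs are those with [r j = 0] and
    [h j = h i], and minimality of [h j] already forces [r j = 0]. *)
Lemma doubled_argmin_split_height h r :
  let D := doubled (argmin (split_height h r)) in
  D = finset.set0 \/ D = argmin h.
Proof.
move=> D; have [->|/set0Pn[i]] := eqVneq D finset.set0; first by left.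
rewrite /D inE => /andP[/argminP il /argminP ir]; right.
have minl j : h i + r i <= h j + r j.
  by have := il (lshift n j); rewrite !split_height_l.
have minr j : h i + r i <= h j - r j.
  by have := il (rshift n j); rewrite split_height_l split_height_r.
have ri : r i = 0.
  have := minr i; have := ir (lshift n i).
  rewrite split_height_l split_height_r; lra.
apply/setP => j; rewrite /D inE; apply/andP/argminP => [[/argminP jl /argminP jr] x|jmin].
  have := jl (lshift n i); have := jr (lshift n i).
  rewrite !split_height_l split_height_r.
  by have := minl x; have := minr x; lra.
have := jmin i; have := minl j; have := minr j => j1 j2 j3.
have rj : r j = 0 by lra.
split; apply/argminP => x; case: (split_ordP x) => y ->;
  rewrite !(split_height_l, split_height_r);
  by have := minl y; have := minr y; lra.
Qed.

(* The level [mu] is the common value of the points of [C]: copies occurring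
   alone are pulled down to it, at the cost of pushing their twins up. *)
Lemma argmin_split_height h (mu : R) C : C != finset.set0 ->
  (forall i, mu <= h i) -> (forall i, (i \in doubled C) = (h i == mu)) ->
  exists r, argmin (split_height h r) = C.
Proof.
move=> C0 muh DE.
exists (fun i => (mu - h i) * ((lshift n i \in C)%:R - (rshift n i \in C)%:R)).
apply: (@argmin_level _ _ _ mu) => // j; case: (split_ordP j) => i ->;
  rewrite !(split_height_l, split_height_r); have := muh i; have := DE i;
  rewrite inE; case: (lshift n i \in C); case: (rshift n i \in C) => /=;
  move=> /esym/eqP-E hi; rewrite ?subrr ?subr0 ?sub0r ?mulr0 ?mulr1 ?mulrN1;
  try lra.
all: by apply/esym/eqP; lra.
Qed.

Lemma argmin_split_heightP h C : (0 < n)%N ->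
  (exists r, C = argmin (split_height h r)) <->
  C != finset.set0 /\ (doubled C = finset.set0 \/ doubled C = argmin h).
Proof.
move=> n0; split=> [[r ->]|[C0 CD]].
  split; [|exact: doubled_argmin_split_height].
  by apply: argmin_neq0; rewrite addn_gt0 n0.
have /set0Pn[i0 /argminP i0min] := argmin_neq0 h n0.
suff [mu [muh DE]] : exists mu, (forall i, mu <= h i) /\
    (forall i, (i \in doubled C) = (h i == mu)).
  by have [r <-] := argmin_split_height C0 muh DE; exists r.
case: CD => ->.
  (* With no complete pair, any level strictly below the minimum of [h] works, as no label attains
     it; otherwise the level is that minimum. *)
  exists (h i0 - 1); split=> i; have := i0min i; first lra.
  by rewrite finset.in_set0 => ?; apply/esym/eqP; lra.
exists (h i0); split=> // i.
apply/argminP/eqP => [imin|-> //].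
by apply/eqP; rewrite eq_le imin i0min.
Qed.

End DoubledHeights.

(** * The polytope: vertices, subdivisions and dimension *)

Section DoubledConfiguration.
Context {R : realType} {k n : nat} (a : 'I_n -> 'rV[R]_k).

Definition double_config (j : 'I_(n + n)) : 'rV[R]_(k + n) :=
  match fintype.split j with
  | inl i => row_mx (a i) (delta_mx 0 i)
  | inr i => row_mx (a i) (- delta_mx 0 i)
  end.

Lemma double_config_l i :
  double_config (lshift n i) = row_mx (a i) (delta_mx 0 i).
Proof. by rewrite /double_config (unsplitK (inl i)). Qed.

Lemma double_config_r i :
  double_config (rshift n i) = row_mx (a i) (- delta_mx 0 i).
Proof. by rewrite /double_config (unsplitK (inr i)). Qed.

(** A linear functional shifts the means only through [c], and the half differences freely through
    [s]. *)
Lemma double_config_functional (c : 'cV[R]_k) (s : 'cV[R]_n) j :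
  (double_config j *m col_mx c s) 0 0
  = split_height (fun i => (a i *m c) 0 0) (s^~ 0) j.
Proof.
by case: (split_ordP j) => i ->;
  rewrite ?double_config_l ?double_config_r ?split_height_l ?split_height_r;
  rewrite mul_row_col mxE ?mulNmx -rowE !mxE.
Qed.

(** Up to sign, the added coordinate of the pair of [j] takes the value -1 at [j], 1 at its twin and
    0 at all other points. *)
Lemma double_config_unique_min j : exists c : 'cV[R]_(k + n), forall j', j' != j ->
  (double_config j *m c) 0 0 < (double_config j' *m c) 0 0.
Proof.
case: (split_ordP j) => i -> {j};
  [exists (col_mx 0 (- delta_mx i 0))|exists (col_mx 0 (delta_mx i 0))];
  move=> j'; case: (split_ordP j') => i' ->;
  rewrite ?(inj_eq (@lshift_inj _ _)) ?(inj_eq (@rshift_inj _ _)) ?eq_lrshift ?eq_rlshift;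
  move=> ne; rewrite !double_config_functional ?split_height_l ?split_height_r;
  rewrite !mulmx0 !mxE !eqxx ?andbT ?(negPf ne) /=; try lra;
  case: (i' == i) => /=; lra.
Qed.

Lemma double_config_inj : injective double_config.
Proof.
move=> j j' E; apply/eqP/contraT; rewrite eq_sym => ne.
by have [c /(_ _ ne)] := double_config_unique_min j; rewrite E ltxx.
Qed.

Lemma range_double_config : (0 < n)%N ->
  range double_config = vertices (convex_hull (range double_config)).
Proof.
move=> n0; apply/seteqP; split => [_ [j _ <-]|v [c cv]].
  have [c cmin] := double_config_unique_min j.
  apply: (@vertices_unique_min _ _ _ c); first by exists j.
  move=> _ [j' _ <-] ne; apply: cmin; apply/eqP => jj'; exact/ne/congr1.
(* The functional defining a vertex [v] attains its minimum over the generators at one of them,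
   which lies in the face and so equals [v]. *)
have nn0 : (0 < n + n)%N by rewrite addn_gt0 n0.
have /set0Pn[j /argminP jmin] :=
  argmin_neq0 (fun j => (double_config j *m c) 0 0) nn0.
exists j => //.
suff : face (convex_hull (range double_config)) c (double_config j).
  by rewrite cv.
apply/face_convex_hull_gen; first by exists j.
by move=> _ [j' _ <-]; exact: jmin.
Qed.

Lemma induced_subdivision_double_config (w' : 'I_(n + n) -> R) : (0 < n)%N ->
  induced_subdivision double_config w' = double_subdivision
    (induced_subdivision a
      (fun i => (w' (lshift n i) + w' (rshift n i)) / 2)).
Proof.
set w := (fun i => _); move=> n0.
(* The half differences of [w'] are absorbed by the added coordinates of the functional: taking
   [s = r - z] realizes any [r]. Only the means [w] matter. *)
pose z i := (w' (lshift n i) - w' (rshift n i)) / 2.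
pose h (c : 'cV[R]_k) i := (a i *m c) 0 0 + w i.
have heightE c (s : 'cV[R]_n) :
    (fun j => (double_config j *m col_mx c s) 0 0 + w' j)
    = split_height (h c) (fun i => s i 0 + z i).
  apply/funext => j; rewrite double_config_functional.
  by case: (split_ordP j) => i ->;
    rewrite ?split_height_l ?split_height_r /h /w /z; lra.
have cellP C : C \in induced_subdivision double_config w' <->
    exists c r, C = argmin (split_height (h c) r).
  rewrite in_induced_subdivision; split=> [[c ->]|[c [r ->]]].
    by rewrite -[c]vsubmxK heightE; do 2 eexists.
  exists (col_mx c (\col_i (r i - z i))); rewrite heightE.
  by congr (argmin (split_height _ _)); apply/funext => i; rewrite mxE subrK.
apply/setP => C; rewrite [in RHS]inE; apply/idP/andP.
  move=> /cellP[c Cc].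
  have [C0 [D0|DE]] := (argmin_split_heightP (h c) C n0).1 Cc; split=> //.
    by rewrite D0 eqxx.
  by apply/orP; right; apply/in_induced_subdivision; exists c.
move=> [C0 /orP[/eqP D0|/in_induced_subdivision[c DE]]]; apply/cellP.
  by exists 0; apply/argmin_split_heightP => //; split=> //; left.
by exists c; apply/argmin_split_heightP => //; split=> //; right.
Qed.

Lemma regular_subdivision_neq0 S : (0 < n)%N -> regular_subdivisions a S ->
  forall D, D \in S -> D != finset.set0.
Proof.
by move=> n0 [w _ <-] D /in_induced_subdivision[c ->]; exact: argmin_neq0.
Qed.

Lemma isomorphic_double_config : (0 < n)%N ->
  isomorphic_secondary_polytopes a double_config.
Proof.
move=> n0; exists double_subdivision; split; last first.
  move=> S T Sa _; apply: refines_double_subdivision.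
  exact: regular_subdivision_neq0 Sa.
split.
- move=> _ [w _ <-].
  (* Both copies receive the height of the original point, so the mean is [w] again. *)
  exists (fun j => w (match fintype.split j with inl i => i | inr i => i end)) => //.
  rewrite induced_subdivision_double_config//.
  congr (double_subdivision (induced_subdivision _ _)); apply/funext => i.
  by rewrite (unsplitK (inl i)) (unsplitK (inr i)); lra.
- move=> S T; rewrite !inE => Sa Ta.
  by apply: double_subdivision_inj; exact: regular_subdivision_neq0.
- by move=> _ [w' _ <-]; rewrite induced_subdivision_double_config//;
  eexists => //; eexists.
Qed.

Lemma lsubmx_affine_hull_double_config y :
  convex_hull (range double_config) y -> affine_hull (range a) (lsubmx y).
Proof.
move=> [q [x [l [px _ l1 ->]]]].
exists q, (fun i => lsubmx (x i)), l; split=> //.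
  move=> i; have [j _ <-] := px i.
  by case: (split_ordP j) => i' ->;
    rewrite ?double_config_l ?double_config_r row_mxKl; exists i'.
by rewrite linear_sum; apply: eq_bigr => i _; rewrite linearZ.
Qed.

Lemma affine_hull_double_config y :
  affine_hull (range a) (lsubmx y) ->
  affine_hull (convex_hull (range double_config)) y.
Proof.
move=> /affine_hull_range[l [l1 yE]].
(* The two weights of the pair [i] sum to [l i], which gives the first block, and differ by the
   added coordinate [i] of [y], which gives the second. They may be negative. *)
exists (n + n)%N, double_config,
  (split_height (fun i => l i / 2) (fun i => rsubmx y 0 i / 2)); split.
- by move=> j; apply: convex_hull_sub; exists j.
- rewrite big_split_ord /= -big_split /= -[RHS]l1; apply: eq_bigr => i _.
  by rewrite split_height_l split_height_r; lra.
- rewrite big_split_ord /= -big_split /= -[LHS]hsubmxK yE.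
  rewrite {1}[rsubmx y]row_sum_delta.
  rewrite -[RHS]hsubmxK !linear_sum; congr row_mx; apply: eq_bigr => i _.
    rewrite split_height_l split_height_r double_config_l double_config_r.
    rewrite linearD !linearZ /= !row_mxKl -scalerDl; congr (_ *: _); lra.
  rewrite split_height_l split_height_r double_config_l double_config_r.
  rewrite linearD !linearZ /= !row_mxKr scalerN -scalerBl; congr (_ *: _); lra.
Qed.

(** The affine hull of the polytope is the full preimage of that of [a] under the projection to the
    first [k] coordinates, whose kernel has dimension [n]. *)
Lemma has_dimension_double_config d : has_dimension (range a) d ->
  has_dimension (convex_hull (range double_config)) (d + n).
Proof.
move=> [x0 [V [dV aV]]].
pose f : 'Hom('rV[R]_(k + n), 'rV[R]_k) := linfun lsubmx.
have fE y : f y = lsubmx y by rewrite lfunE.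
have f_onto : limg f = fullv.
  apply/vspaceP => v; rewrite memvf; apply/memv_imgP.
  by exists (row_mx v 0); rewrite ?memvf// fE row_mxKl.
exists (row_mx x0 0), (f @^-1: V)%VS; split.
  (* Rank-nullity is used twice: on the whole space it gives the dimension of the kernel, on the
     preimage of [V] the sum [d + n]. *)
  have /eqP := limg_ker_dim f fullv.
  rewrite capfv f_onto !dimvf /dim /= !mul1n addnC eqn_add2l => /eqP kerf.
  have := limg_ker_dim f (f @^-1: V).
  rewrite lpreimK ?f_onto ?subvf// dV.
  have /capv_idPr-> : (lker f <= f @^-1: V)%VS by rewrite -[lker f]lpreim0 lpreimS// sub0v.
  by rewrite kerf addnC.
have aVP v : affine_hull (range a) v <-> v - x0 \in V.
  rewrite aV; split=> [[u uV <-]|vV]; first by rewrite addrC addKr.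
  by exists (v - x0) => //; rewrite addrC subrK.
apply/seteqP; split=> [y [q [x [l [Px l1 ->]]]]|_ [v /= vV <-]].
  exists (\sum_i l i *: x i - row_mx x0 0); last by rewrite addrC subrK.
  rewrite /= -memv_preim fE linearB /= row_mxKl linear_sum /=.
  rewrite -[x0]scale1r -l1 scaler_suml -sumrB; apply: memv_suml => i _.
  rewrite linearZ /= -scalerBr memvZ//; apply/aVP.
  exact: lsubmx_affine_hull_double_config.
apply: affine_hull_double_config; apply/aVP.
by rewrite linearD /= row_mxKl addrAC subrr add0r -fE memv_preim.
Qed.

End DoubledConfiguration.

Theorem theorem3p1 (R : realType) (k d n : nat) (a : 'I_n -> 'rV[R]_k) :
  has_dimension (range a) d ->
  exists m : nat, (m <= n)%N /\
  exists (N : nat) (P : set 'rV[R]_N),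
    [/\ is_polytope P, has_dimension P (d + m)%N
      & exists p : 'I_(n + m) -> 'rV[R]_N,
          [/\ injective p, range p = vertices P
            & isomorphic_secondary_polytopes a p]].
Proof.
move=> da.
(* An empty configuration has an empty affine hull, since an empty sum of weights is not 1, and
   hence no dimension. *)
have n0 : (0 < n)%N.
  case: n a da => // a [x0 [V [_ aV]]].
  have : affine_hull (range a) x0.
    by rewrite aV; exists 0; rewrite ?addr0//=; exact: mem0v.
  move=> /affine_hull_range[l []]; rewrite big_ord0 => /eqP.
  by rewrite eq_sym oner_eq0.
exists n; split=> //; exists (k + n)%N, (convex_hull (range (double_config a))).
split.
- by exists (range (double_config a)); split=> //; exact: finite_image.
- exact: has_dimension_double_config.
- exists (double_config a); split.
  + exact: double_config_inj.
  + exact: range_double_config.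
  + exact: isomorphic_double_config.
Qed.
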